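(* In the setting below, the common bases of $(\vec A_1,\vec A_2)$ are in one-to-one correspondence with the disjoint $S$--$T$ paths of $G$. In addition, if $(S,T)$ is in the LGV position on $G$, then $(\vec A_1,\vec A_2)$ is a Pfaffian pair with constant $\pm1$.
   Context: $G=(V,E)$ is a directed acyclic graph; $S=\{s_1,\dots,s_k\}$, $T=\{t_1,\dots,t_k\}$ are disjoint vertex subsets with $|S|=|T|=k$; every $s_i$ has in-degree $0$ and every $t_j$ has out-degree $0$. A disjoint $S$--$T$ path is a union of $k$ pairwise vertex-disjoint directed paths $P_1,\dots,P_k$ with $P_i$ from $s_i$ to $t_{\sigma_P(i)}$ for a permutation $\sigma_P$; $\operatorname{sgn}P=\operatorname{sgn}\sigma_P$. $(S,T)$ is in the LGV position if $\operatorname{sgn}P$ is the same for all disjoint $S$--$T$ paths. Let $\tilde V=V\setminus(S\cup T)$, $\tilde V_S,\tilde V_T$ disjoint copies of $\tilde V$ ($v_s,v_t$ the copies of $v$; $v_s=v$ for $v\in S$, $v_t=v$ for $v\in T$). $\Gamma$ is bipartite with parts $V_S=S\cup\tilde V_S$, $V_T=T\cup\tilde V_T$ and edges $F=F_1\cup F_2$, $F_1=\{\{u_s,v_t\}:(u,v)\in E\}$, $F_2=\{\{v_s,v_t\}:v\in\tilde V\}$; $\vec\Gamma$ orients $F_1$ from $V_T$ to $V_S$ and $F_2$ from $V_S$ to $V_T$. Order $V_S$ with $s_1,\dots,s_k$ first and $V_T$ with $t_1,\dots,t_k$ first. Let $A_U\in\mathbb{Q}^{V_S\times F}$ and $A_V\in\mathbb{Q}^{V_T\times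 F}$ have entry $1$ at $(x,e)$ if $x\in e$ and $0$ otherwise (rows in these orders, columns in a common fixed order of $F$); let $s_e=+1$ if $e$ is oriented from $V_S$ to $V_T$ and $-1$ otherwise; $\vec A_1=A_U\operatorname{diag}(s_e)_{e\in F}$, $\vec A_2=A_V$. A common base is a column set $B$ with $\vec A_1[B],\vec A_2[B]$ both square nonsingular; the pair is Pfaffian with constant $c\neq0$ if $\det\vec A_1[B]\det\vec A_2[B]=c$ for all common bases. *)

(* Defs.v *)
From HB Require Import structures.
From mathcomp Require Import all_boot all_algebra perm.

Set Implicit Arguments.
Unset Strict Implicit.
Unset Printing Implicit Defensive.

Import GRing.Theory.
Local Open Scope ring_scope.

Definition acyclic (V : finType) (E : rel V) : Prop :=
  forall c : seq V, c != [::] -> ~~ cycle E c.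

Definition enumerates (X : finType) (n : nat) (f : 'I_n -> X) (A : {set X}) :
  Prop := injective f /\ f @: setT = A.

Section PathFamilies.
Variables (V : finType) (E : rel V) (k : nat) (s t : 'I_k -> V).

(* A disjoint S-T path is a pair [P] of a family of routes and the permutation
   sigma_P; the vertices of P_i are, in order, [s i :: P.1 i].  As P_i is
   indexed by its source, distinct such pairs have distinct unions. *)
Definition route (P : {ffun 'I_k -> seq V} * {perm 'I_k}) (i : 'I_k) : seq V :=
  s i :: P.1 i.

Definition is_disjoint_path (P : {ffun 'I_k -> seq V} * {perm 'I_k}) : bool :=
  [&& [forall i, [&& path E (s i) (P.1 i), uniq (route P i)
                   & last (s i) (P.1 i) == t (P.2 i)]]
    & [forall i, forall j, (i != j) ==> ~~ has (mem (route P i)) (route P j)]].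

Definition disjoint_path : Type :=
  {P : {ffun 'I_k -> seq V} * {perm 'I_k} | is_disjoint_path P}.

Definition sgn_path (P : disjoint_path) : int := (-1) ^+ odd_perm (val P).2.

Definition LGV_position : Prop :=
  forall P Q : disjoint_path, sgn_path P = sgn_path Q.

Definition path_verts (P : disjoint_path) : {set V} :=
  [set v | [exists i, v \in route (val P) i]].

Definition path_arcs (P : disjoint_path) : {set V * V} :=
  [set a | [exists i, a \in zip (route (val P) i) ((val P).1 i)]].

End PathFamilies.

Section BipartiteGraph.
Variables (V : finType) (E : rel V) (k : nat) (s t : 'I_k -> V).

Definition sources : {set V} := [set s i | i : 'I_k].
Definition sinks : {set V} := [set t i | i : 'I_k].
Definition inner : {set V} := ~: (sources :|: sinks).

(* In the vertex type [V + V] of Gamma, [inl v] is v_s and [inr v] is v_t.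
   Only the elements of [VS :|: VT] are vertices of Gamma. *)
Definition VS : {set V + V} := [set inl v | v in sources :|: inner].
Definition VT : {set V + V} := [set inr v | v in sinks :|: inner].

Definition F1_edge (a : V * V) : {set V + V} := [set inl a.1; inr a.2].
Definition F2_edge (v : V) : {set V + V} := [set inl v; inr v].

Definition F1 : {set {set V + V}} := [set F1_edge a | a : V * V & E a.1 a.2].
Definition F2 : {set {set V + V}} := [set F2_edge v | v in inner].
Definition F : {set {set V + V}} := F1 :|: F2.

Definition Gamma_arc (x y : V + V) : bool :=
  [&& x \in VT, y \in VS & [set x; y] \in F1]
  || [&& x \in VS, y \in VT & [set x; y] \in F2].

Definition edge_sign (e : {set V + V}) : rat :=
  if [exists x in VS, exists y in VT, (e == [set x; y]) && Gamma_arc x y]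
  then 1 else -1.

Definition incidence_mx (r m : nat) (row : 'I_r -> V + V)
    (col : 'I_m -> {set V + V}) : 'M[rat]_(r, m) :=
  \matrix_(i, j) (row i \in col j)%:R.

Definition vecA1 (r m : nat) (rowS : 'I_r -> V + V)
    (col : 'I_m -> {set V + V}) : 'M[rat]_(r, m) :=
  incidence_mx rowS col *m diag_mx (\row_j edge_sign (col j)).

Definition vecA2 (r m : nat) (rowT : 'I_r -> V + V)
    (col : 'I_m -> {set V + V}) : 'M[rat]_(r, m) :=
  incidence_mx rowT col.

(* The perfect matching of Gamma that uses the arcs of [P] and the edges
   {v_s, v_t} for the inner vertices v off [P]. *)
Definition path_matching (P : disjoint_path E s t) : {set {set V + V}} :=
  [set F1_edge a | a in path_arcs P]
  :|: [set F2_edge v | v in inner :\: path_verts P].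

End BipartiteGraph.

Section PfaffianPairs.
Variables (R : fieldType) (r m : nat).

(* Columns of [A] indexed by [B], in increasing order; meaningful only when
   #|B| = r, and the zero matrix otherwise. *)
Definition col_submx (A : 'M[R]_(r, m)) (B : {set 'I_m}) : 'M[R]_r :=
  conform_mx 0 (colsub (fun j : 'I_#|B| => enum_val j) A).

Definition common_base (A1 A2 : 'M[R]_(r, m)) (B : {set 'I_m}) : bool :=
  [&& #|B| == r, col_submx A1 B \in unitmx & col_submx A2 B \in unitmx].

Definition Pfaffian_pair (A1 A2 : 'M[R]_(r, m)) (c : R) : Prop :=
  c != 0 /\ forall B : {set 'I_m}, common_base A1 A2 B ->
    \det (col_submx A1 B) * \det (col_submx A2 B) = c.

End PfaffianPairs.

(* Main.v *)
Require Import Defs.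
From HB Require Import structures.
From mathcomp Require Import all_boot all_algebra perm.

(* Each column of A1 or A2 has a single nonzero entry, so the common bases are
   the perfect matchings of Gamma, and det A1[B] det A2[B] is the determinant of
   A1[B] A2[B]^T, a signed permutation matrix.  A perfect matching is a map g
   sending u to v when u_s and v_t are matched; by acyclicity its non-fixed
   points form exactly the walks iterating g from the s_i until they meet T, which
   is a disjoint S-T path, the edges of F2 covering the vertices off the path.

   For the signs, contract each t_i with s_i.  The matching becomes a permutation
   whose first return to {s_1, .., s_k} is sigma_P and whose orbits missing this
   set are fixed points.  Counting orbits, its sign is (-1)^#F1(B) sgn(sigma_P) up
   to a factor depending only on k and the row orders; and (-1)^#F1(B) is cancelled
   by the edge signs. *)

Set Implicit Arguments.
Unset Strict Implicit.
Unset Printing Implicit Defensive.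

Import GRing.Theory.
Local Open Scope ring_scope.

(** * Acyclic walks, parity by orbit counting, and products of column submatrices *)

Lemma acyclic_uniq (V : finType) (E : rel V) (x : V) (p : seq V) :
  acyclic E -> path E x p -> uniq (x :: p).
Proof.
move=> acE; elim: p x => [//|y p IHp] x pathp.
have /andP[_ /IHp uniqp] := pathp.
rewrite cons_uniq uniqp andbT; apply/negP => xp.
case/splitPr: xp pathp => p1 p2; rewrite -cat_rcons cat_path => /andP[cyc _].
by have := acE (x :: p1) isT; rewrite /cycle cyc.
Qed.

Lemma acyclic_irrefl (V : finType) (E : rel V) (x : V) : acyclic E -> E x x = false.
Proof. by move=> /(_ [:: x] isT); rewrite /= andbT => /negbTE. Qed.

(** Serves to extract permutations of row indices from relations that compare vertices. A choice
    function is injective by the last hypothesis, hence a permutation, and uniqueness of the image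
    makes it describe the whole relation. *)
Lemma perm_of_rel (n : nat) (r : rel 'I_n) :
    (forall i, exists j, r i j) ->
    (forall i j j', r i j -> r i j' -> j = j') ->
    (forall i i' j, r i j -> r i' j -> i = i') ->
  exists pi : {perm 'I_n}, forall i j, r i j = (j == pi i).
Proof.
move=> /fin_all_exists[f rf] rfun rinj.
have f_inj : injective f.
  by move=> i i' eqf; apply: (rinj _ _ (f i)) => //; rewrite eqf.
exists (perm f_inj) => i j; rewrite permE; apply/idP/eqP => [rij|->//].
exact: rfun rij (rf i).
Qed.

(* A permutation is odd iff the number of points minus the number of orbits is;
   the orbits of phi are those meeting the image of iota, in bijection with the
   orbits of sg, and the singletons of off. *)
Lemma odd_perm_return (X T : finType) (sg : {perm X}) (phi : {perm T})
    (iota : X -> T) (off : {set T}) :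
    (forall x y, (iota y \in porbit phi (iota x)) = (y \in porbit sg x)) ->
    off = [set z | [forall x, z \notin porbit phi (iota x)]] ->
    (forall z, z \in off -> phi z = z) ->
  odd_perm phi = odd_perm sg (+) odd #|T| (+) odd #|off| (+) odd #|X|.
Proof.
move=> orbE offE offfix.
have porbit_off z : z \in off -> porbit phi z = [set z].
  move=> zoff; apply/setP => y; rewrite inE.
  apply/porbitP/eqP => [[i ->]|->]; last by exists 0%N; rewrite expg0 perm1.
  by elim: i => [|i IH]; rewrite ?expg0 ?perm1 // expgSr permM IH offfix.
(* [h] sends an orbit of [sg] to the orbit of [phi] through its image. Taking the union over the
   orbit avoids choosing a representative, since all its members give the same set. *)
pose h (O : {set X}) := \bigcup_(x in O) porbit phi (iota x).
have hE x : h (porbit sg x) = porbit phi (iota x).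
  apply/setP => z; apply/bigcupP/idP => [[y]|zx]; last by exists x; rewrite ?porbit_id.
  by rewrite -orbE -eq_porbit_mem => /eqP->.
have porbitsE : porbits phi = h @: porbits sg :|: [set [set z] | z in off].
  apply/setP => O; rewrite inE; apply/imsetP/orP.
    case=> z _ ->; case: (boolP (z \in off)) => zoff.
      by right; rewrite porbit_off // imset_f.
    left; move: zoff; rewrite offE inE negb_forall => /existsP[x].
    rewrite negbK -eq_porbit_mem => /eqP->.
    by rewrite -hE imset_f // imset_f.
  case=> /imsetP[].
    by move=> _ /imsetP[x _ ->] ->; exists (iota x); rewrite ?hE.
  by move=> z zoff ->; exists z; rewrite ?porbit_off.
have disj : [disjoint h @: porbits sg & [set [set z] | z in off]].
  rewrite -setI_eq0; apply/eqP/setP => O; rewrite !inE.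
  apply/negP => /andP[/imsetP[_ /imsetP[x _ ->] ->] /imsetP[z zoff]].
  rewrite hE => eqO; move: zoff; rewrite offE inE => /forallP/(_ x)/negP; apply.
  by rewrite eqO set11.
have hinj : {in porbits sg &, injective h}.
  move=> _ _ /imsetP[x _ ->] /imsetP[y _ ->]; rewrite !hE => eqO.
  by apply/eqP; rewrite eq_porbit_mem -orbE -eqO porbit_id.
rewrite /odd_perm porbitsE cardsU disjoint_setI0 // cards0 subn0 oddD.
rewrite (card_in_imset hinj) (card_imset _ set1_inj).
by case: (odd #|T|); case: (odd #|X|); case: (odd #|off|); case: (odd _).
Qed.

Lemma mul_col_submx (R : fieldType) (r m : nat) (A1 A2 : 'M[R]_(r, m))
    (B : {set 'I_m}) : #|B| = r ->
  col_submx A1 B *m (col_submx A2 B)^T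
    = \matrix_(i, j) \sum_(l in B) A1 i l * A2 j l.
Proof.
move=> cardB.
(* The number of columns is generalized from [#|B|] to a variable [p], so that [p = r] can be
   substituted and [conform_mx] becomes the identity. *)
have cast p (f : 'I_p -> 'I_m) : p = r ->
    conform_mx (0 : 'M_r) (colsub f A1) *m (conform_mx (0 : 'M_r) (colsub f A2))^T
    = \matrix_(i, j) \sum_l A1 i (f l) * A2 j (f l).
  move=> eqp; subst p; apply/matrixP => i j; rewrite !conform_mx_id !mxE.
  by apply: eq_bigr => l _; rewrite !mxE.
rewrite /col_submx cast //; apply/matrixP => i j; rewrite !mxE.
by rewrite [RHS]big_enum_val.
Qed.

Lemma common_baseE (R : fieldType) (r m : nat) (A1 A2 : 'M[R]_(r, m))
    (B : {set 'I_m}) :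
  common_base A1 A2 B = (#|B| == r)
    && (\matrix_(i, j) (\sum_(l in B) A1 i l * A2 j l) \in unitmx).
Proof.
rewrite /common_base; case: eqP => //= cardB.
by rewrite -mul_col_submx // unitmx_mul unitmx_tr.
Qed.

Lemma unitmx_row_neq0 (R : fieldType) (n : nat) (A : 'M[R]_n) (i : 'I_n) :
  A \in unitmx -> exists j, A i j != 0.
Proof.
move=> Aunit; case: (pickP (fun j => A i j != 0)) => [j|A0]; first by exists j.
have := congr1 (fun M : 'M_n => M i i) (mulmxV Aunit).
rewrite !mxE eqxx big1 => [/esym/eqP|j _]; first by rewrite oner_eq0.
by have /negbFE/eqP-> := A0 j; rewrite mul0r.
Qed.

(** * Perfect matchings of Gamma as functions on vertices *)

Section Matchings.
Variables (V : finType) (E : rel V) (k : nat) (s t : 'I_k -> V).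
Hypotheses (acyclicE : acyclic E) (s_inj : injective s) (t_inj : injective t).
Hypothesis disjST : [disjoint sources s & sinks t].
Hypothesis s_in0 : forall (i : 'I_k) (v : V), ~~ E v (s i).
Hypothesis t_out0 : forall (j : 'I_k) (v : V), ~~ E (t j) v.

Local Notation sinks := (sinks t).
Local Notation sources := (sources s).
Local Notation inner := (inner s t).

Definition gamma_edge (u v : V) : bool := E u v || ((u == v) && (u \in inner)).

(* A perfect matching of Gamma, seen as the map sending u to the v such that
   u_s and v_t are matched; its values on the sinks are junk. *)
Definition matching_fun (g : V -> V) : Prop :=
  (forall v, v \notin sinks -> gamma_edge v (g v))
  /\ {in [predC sinks] &, injective g}.

(** The edges of [path_matching P] read as a relation: [u] and [v] are related when u_s and v_t are
    matched. *)
Definition path_rel (P : disjoint_path E s t) (u v : V) : bool :=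
  ((u, v) \in path_arcs P) || ((u == v) && (u \in inner :\: path_verts P)).

Lemma source_notin_sinks i : s i \notin sinks.
Proof.
by apply/negP => si; move/pred0P/(_ (s i)): disjST; rewrite /= si imset_f.
Qed.

Lemma inner_notin v : v \in inner -> (v \notin sources) /\ (v \notin sinks).
Proof. by rewrite !inE negb_or => /andP[]. Qed.

Lemma gamma_edge_notin u v :
  gamma_edge u v -> (u \notin sinks) /\ (v \notin sources).
Proof.
case/orP => [Euv|/andP[/eqP<- /inner_notin[]]//].
split; apply/imsetP => -[i _ eqi].
  by move: (t_out0 i v); rewrite -eqi Euv.
by move: (s_in0 i u); rewrite -eqi Euv.
Qed.

(** * From a matching to a disjoint path, by iterating the matching function *)

Section Walks.
Variable g : V -> V.
Hypothesis gP : matching_fun g.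

(** Ensures that the first [n] iterations of [g] from [v] never use a junk value; the vertex reached
    after [n] steps may itself be a sink. *)
Definition avoids_sinks (v : V) (n : nat) : Prop :=
  forall j, (j < n)%N -> iter j g v \notin sinks.

Lemma iter_neq_source v n i : avoids_sinks v n.+1 -> iter n.+1 g v != s i.
Proof.
move=> /(_ n (ltnSn n)) /gP.1 /gamma_edge_notin[_]; rewrite iterS.
by apply: contraNneq => ->; rewrite imset_f.
Qed.

(** Injectivity of [g] off the sinks lets the two walks be traced back together, one step at a time,
    until the shorter one is at its start. *)
Lemma iter_merge x y a b :
    avoids_sinks x a -> avoids_sinks y b -> (a <= b)%N ->
  iter a g x = iter b g y -> x = iter (b - a) g y.
Proof.
elim: a b => [|a IH] [|b] //= ax ay le_ab eq_it.
apply: IH => //; first by move=> j lt_ja; apply: ax; apply: ltnW.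
  by move=> j lt_jb; apply: ay; apply: ltnW.
by apply: gP.2 => //; rewrite inE; [apply: ax|apply: ay].
Qed.

(** Tracing back, the walk from [s i] cannot be the shorter one: [s i] would then be a positive
    iterate of [v], while no edge of Gamma matches anything to a source. *)
Lemma iter_source_merge i v a b :
    avoids_sinks (s i) a -> avoids_sinks v b -> iter a g (s i) = iter b g v ->
  (b <= a)%N /\ v = iter (a - b) g (s i).
Proof.
move=> ai bv eq_it; case: (leqP b a) => [le_ba|lt_ab].
  by split=> //; apply: iter_merge (esym eq_it).
have := iter_merge ai bv (ltnW lt_ab) eq_it.
case def_c: (b - a)%N => [|c]; first by move: lt_ab; rewrite -subn_gt0 def_c.
move=> eq_si; have /eqP[] : iter c.+1 g v != s i.
  apply: iter_neq_source => j lt_jc; apply: bv.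
  by apply: leq_trans lt_jc _; rewrite -def_c leq_subr.
by [].
Qed.

Lemma iter_source_inj i i' a b :
    avoids_sinks (s i) a -> avoids_sinks (s i') b ->
  iter a g (s i) = iter b g (s i') -> i = i' /\ a = b.
Proof.
move=> ai bi' eq_it.
have [le_ba eq1] := iter_source_merge ai bi' eq_it.
have [le_ab _] := iter_source_merge bi' ai (esym eq_it).
have eqab : a = b by apply/eqP; rewrite eqn_leq le_ab.
by split=> //; apply: s_inj; rewrite eq1 eqab subnn.
Qed.

Lemma moved_arc v : v \notin sinks -> g v != v -> E v (g v).
Proof. by move=> /gP.1 /orP[//|/andP[/eqP<-]]; rewrite eqxx. Qed.

(** A walk that moves at its first step never stops before a sink: by injectivity, a fixed iterate
    would force the preceding one to be fixed too. *)
Lemma moved_iter v n : v \notin sinks -> g v != v -> avoids_sinks v n ->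
  forall j, (j < n)%N -> E (iter j g v) (iter j.+1 g v).
Proof.
move=> vT mv an; suff mn j : (j < n)%N -> iter j.+1 g v != iter j g v.
  by move=> j lt_jn; apply: moved_arc; [apply: an|apply: mn].
elim: j => [//|j IH] lt_jn; have := IH (ltnW lt_jn); apply: contra_neq.
by apply: gP.2; rewrite inE; apply: (an _.+1, an _).1 || apply: an; rewrite ?(ltnW lt_jn).
Qed.

Lemma walk_path v n : v \notin sinks -> g v != v -> avoids_sinks v n ->
  path E v (traject g (g v) n).
Proof.
move=> vT mv an; apply/(pathP v) => i; rewrite size_traject => lt_in.
have -> : v :: traject g (g v) n = traject g v n.+1 by [].
rewrite nth_traject; last exact: ltnW.
rewrite (set_nth_default (g v)) ?size_traject // nth_traject // -iterSr.
exact: moved_iter an i lt_in.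
Qed.

(** As long as it meets no sink, the walk follows arcs of [E]. By acyclicity its vertices are
    distinct, so it cannot have [#|V|.+1] of them. *)
Lemma reach_sink v : v \notin sinks -> g v != v ->
  exists m, iter m.+1 g v \in sinks /\ avoids_sinks v m.+1.
Proof.
move=> vT mv; have exm : exists m, iter m g v \in sinks.
  pose f (j : 'I_#|V|.+1) := iter j g v \in sinks.
  case: (pickP f) => [j fj|nof]; first by exists j.
  have an : avoids_sinks v #|V|.
    move=> j lt_j; have := nof (Ordinal (ltnW lt_j : (j < #|V|.+1)%N)).
    by rewrite /f /= => ->.
  have /card_uniqP/= := acyclic_uniq acyclicE (walk_path vT mv an).
  rewrite size_traject => card_eq.
  by have := max_card [in v :: traject g (g v) #|V|]; rewrite card_eq ltnn.
case: (ex_minnP exm) => -[|m] mT m_min; first by rewrite mT in vT.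
exists m; split=> // j lt_jm; apply: contraL lt_jm => /m_min.
by rewrite -leqNgt.
Qed.

Lemma source_moved i : g (s i) != s i.
Proof.
by apply: (@iter_neq_source _ 0) => -[|//] _; exact: source_notin_sinks.
Qed.

Lemma disjoint_path_of_matching : exists P : disjoint_path E s t,
  forall v, v \notin sinks -> path_rel P v (g v).
Proof.
have /fin_all_exists[m mP] i := reach_sink (source_notin_sinks i) (source_moved i).
have /fin_all_exists[sg sgP] i : exists j, iter (m i).+1 g (s i) = t j.
  by have /imsetP[j _ ->] := (mP i).1; exists j.
have sg_inj : injective sg.
  move=> i i' eq_sg; apply: (iter_source_inj (mP i).2 (mP i').2 _).1.
  by rewrite !sgP eq_sg.
(* The component [P.1 i] omits the source, so the trajectory starts at [g (s i)]; its [(m i).+1]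
   vertices end at the first sink met. *)
pose P0 := ([ffun i => traject g (g (s i)) (m i).+1], perm sg_inj).
have routeE i : route s P0 i = traject g (s i) (m i).+2 by rewrite /route ffunE.
have P0_path i : path E (s i) (P0.1 i).
  rewrite ffunE; apply: walk_path (mP i).2; last exact: source_moved.
  exact: source_notin_sinks.
have avoid i j : (j < (m i).+2)%N -> avoids_sinks (s i) j.
  by move=> lt_j a lt_a; apply: (mP i).2; apply: leq_trans lt_a _.
have P0P : is_disjoint_path E s t P0.
  apply/andP; split; apply/forallP => i.
    rewrite P0_path (acyclic_uniq acyclicE (P0_path i)) ffunE last_traject /=.
    by rewrite permE -iterS sgP.
  apply/forallP => i'; apply/implyP; apply: contraNN => /hasP[v].
  rewrite /= !routeE => /trajectP[a lt_a ->] /trajectP[b lt_b] eq_it.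
  by apply/eqP; apply: (iter_source_inj (avoid _ _ lt_b) (avoid _ _ lt_a) (esym eq_it)).1.
exists (exist _ P0 P0P) => v vT.
have arcP i j : (j < (m i).+1)%N ->
    (iter j g (s i), iter j.+1 g (s i)) \in path_arcs (exist _ P0 P0P).
  move=> lt_j; rewrite inE; apply/existsP; exists i.
    rewrite [route _ _ i]routeE [X in zip _ X]ffunE.
  apply/(nthP (s i, s i)); exists j.
    by rewrite size_zip !size_traject (minn_idPr (leqnSn _)).
  rewrite nth_zip_cond size_zip !size_traject (minn_idPr (leqnSn _)) // lt_j.
  rewrite [X in (X, _)]nth_traject; last exact: ltnW.
    by rewrite (set_nth_default (g (s i))) ?size_traject // nth_traject // -iterSr.
case: (boolP (v \in path_verts (exist _ P0 P0P))) => vP.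
  move: vP; rewrite inE => /existsP[i]; rewrite /= routeE => /trajectP[j lt_j def_v].
  rewrite /path_rel def_v -iterS arcP // ltn_neqAle -ltnS lt_j andbT.
  by apply: contraNneq vT => eqj; rewrite def_v eqj; apply: (mP i).1.
(* If [g] moved [v], its walk would reach some [t j], where the walk from [s i] with [i] the
   preimage of [j] also ends. Tracing both back would put [v] on that route. *)
have gvv : g v = v.
  apply/eqP; apply: contraNT vP => mv.
  have [b [bT bav]] := reach_sink vT mv.
  have /imsetP[j _ def_j] := bT; pose i := (perm sg_inj)^-1%g j.
  have def_i : iter (m i).+1 g (s i) = iter b.+1 g v.
    by rewrite sgP def_j /i -[sg _]permE permKV.
  have [le_b ->] := iter_source_merge (mP i).2 bav def_i.
  rewrite inE; apply/existsP; exists i; rewrite /= routeE.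
  by apply/trajectP; exists ((m i).+1 - b.+1)%N => //; rewrite ltnS leq_subr.
have := gP.1 v vT; rewrite /gamma_edge gvv (acyclic_irrefl _ acyclicE) eqxx /=.
by rewrite /path_rel eqxx in_setD vP => ->; rewrite orbT.
Qed.

End Walks.

(** * From a disjoint path to a matching *)

Section MatchingOfPath.
Variable P : disjoint_path E s t.

Local Notation p i := ((val P).1 i).
Local Notation r i := (route s (val P) i).

Lemma disjoint_pathP i :
  [/\ path E (s i) (p i), uniq (r i) & last (s i) (p i) = t ((val P).2 i)].
Proof.
by have /andP[/forallP/(_ i)/and3P[? ? /eqP]] := valP P.
Qed.

Lemma route_nth_inj i i' j j' : (j <= size (p i))%N -> (j' <= size (p i'))%N ->
  nth (s i) (r i) j = nth (s i') (r i') j' -> i = i' /\ j = j'.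
Proof.
move=> le_j le_j' eq_nth; have eq_i : i = i'.
  have /andP[_ /forallP/(_ i)/forallP/(_ i')] := valP P.
  move=> /implyP; case: eqP => // _ /(_ isT)/negP[]; apply/hasP.
  exists (nth (s i') (r i') j'); first exact: mem_nth.
  by rewrite -eq_nth; apply: mem_nth.
subst i'; split=> //; apply/eqP.
by rewrite -(nth_uniq (s i) (s := r i)) ?eq_nth //; case: (disjoint_pathP i).
Qed.

Lemma path_arcsP u v : reflect
  (exists i j, [/\ (j < size (p i))%N, u = nth (s i) (r i) j
                 & v = nth (s i) (r i) j.+1])
  ((u, v) \in path_arcs P).
Proof.
rewrite inE; apply: (iffP existsP) => [[i /(nthP (s i, s i))[j]]|[i [j [lt_j -> ->]]]].
  rewrite size_zip (minn_idPr (leqnSn _)) => lt_j.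
  rewrite nth_zip_cond size_zip (minn_idPr (leqnSn _)) lt_j => -[<- <-].
  by exists i, j.
exists i; apply/(nthP (s i, s i)); exists j.
  by rewrite size_zip (minn_idPr (leqnSn _)).
by rewrite nth_zip_cond size_zip (minn_idPr (leqnSn _)) lt_j.
Qed.

Lemma path_vertsP v : reflect
  (exists i j, (j <= size (p i))%N /\ v = nth (s i) (r i) j)
  (v \in path_verts P).
Proof.
rewrite inE; apply: (iffP existsP) => [[i /(nthP (s i))[j lt_j <-]]|[i [j [le_j ->]]]].
  by exists i, j.
by exists i; apply: mem_nth.
Qed.

Lemma path_arcs_edge u v : (u, v) \in path_arcs P -> E u v.
Proof.
case/path_arcsP => i [j [lt_j -> ->]].
by have [/(pathP (s i))/(_ j lt_j)] := disjoint_pathP i.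
Qed.

Lemma path_rel_edge u v : path_rel P u v -> gamma_edge u v.
Proof.
case/orP=> [/path_arcs_edge Euv|/andP[/eqP<-]]; first by rewrite /gamma_edge Euv.
by rewrite in_setD => /andP[_ ui]; rewrite /gamma_edge eqxx ui orbT.
Qed.

Lemma path_arcs_verts u v : (u, v) \in path_arcs P ->
  (u \in path_verts P) && (v \in path_verts P).
Proof.
case/path_arcsP => i [j [lt_j -> ->]]; apply/andP.
by split; apply/path_vertsP; [exists i, j|exists i, j.+1]; split=> //; apply: ltnW.
Qed.

Lemma path_rel_fun u v v' : path_rel P u v -> path_rel P u v' -> v = v'.
Proof.
case/orP=> [uv|/andP[/eqP<- off]] /orP[uv'|/andP[/eqP<-]].
- case/path_arcsP: uv uv' => i [j [lt_j -> ->]] /path_arcsP[i' [j' [lt_j' eqn ->]]].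
  by have [] := route_nth_inj (ltnW lt_j) (ltnW lt_j') eqn => <- <-.
- by rewrite in_setD; case/andP: (path_arcs_verts uv) => ->.
- by move: off; rewrite in_setD; case/andP: (path_arcs_verts uv') => ->.
by [].
Qed.

Lemma path_rel_inj u u' v : path_rel P u v -> path_rel P u' v -> u = u'.
Proof.
case/orP=> [uv|/andP[/eqP-> off]] /orP[uv'|/andP[/eqP->]].
- case/path_arcsP: uv uv' => i [j [lt_j -> ->]] /path_arcsP[i' [j' [lt_j' -> eqn]]].
  by have [<- [<-]] := route_nth_inj lt_j lt_j' eqn.
- by rewrite in_setD; case/andP: (path_arcs_verts uv) => _ ->.
- by move: off; rewrite in_setD; case/andP: (path_arcs_verts uv') => _ ->.
by [].
Qed.

Lemma nth_route_last i : nth (s i) (r i) (size (p i)) = t ((val P).2 i).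
Proof. by have [_ _ <-] := disjoint_pathP i; rewrite (last_nth (s i)). Qed.

Lemma path_rel_total u : u \notin sinks -> exists v, path_rel P u v.
Proof.
move=> uT; case: (boolP (u \in path_verts P)) => [/path_vertsP[i [j [le_j def_u]]]|uP].
  have lt_j : (j < size (p i))%N.
    rewrite ltn_neqAle le_j andbT; apply: contraNneq uT => eq_j.
    by rewrite def_u eq_j nth_route_last imset_f.
  exists (nth (s i) (r i) j.+1); apply/orP; left; apply/path_arcsP.
  by exists i, j.
exists u; rewrite /path_rel eqxx in_setD uP in_setC in_setU negb_or uT !andbT /=.
apply/orP; right; apply: contraNN uP => /imsetP[i _ ->].
by apply/path_vertsP; exists i, 0%N.
Qed.

(** The guard on [u] is there because [g] is arbitrary on the sinks, whereas [path_rel] relates no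
    sink to anything. *)
Definition follows (g : V -> V) : Prop :=
  matching_fun g
  /\ forall u v, path_rel P u v = (u \notin sinks) && (v == g u).

Lemma follows_exists : exists g, follows g.
Proof.
have /fin_all_exists[g gP] u : exists v, u \notin sinks -> path_rel P u v.
  by case: (boolP (u \in sinks)) => [|/path_rel_total[v]]; [exists u|exists v].
exists g; split; first split.
- by move=> v /gP /path_rel_edge.
- by move=> u v uT vT eq_g; apply: (@path_rel_inj _ _ (g v)); [rewrite -eq_g|]; apply: gP.
move=> u v; apply/idP/andP => [uv|[/gP uv /eqP->//]].
have /gamma_edge_notin[uT _] := path_rel_edge uv.
by split=> //; apply/eqP/(path_rel_fun uv)/gP.
Qed.

Section Follows.
Variable g : V -> V.
Hypothesis gP : follows g.

Lemma nth_route i j : (j <= size (p i))%N -> nth (s i) (r i) j = iter j g (s i).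
Proof.
elim: j => [//|j IH] lt_j; rewrite iterS -IH ?(ltnW lt_j) //.
have : path_rel P (nth (s i) (r i) j) (nth (s i) (r i) j.+1).
  by apply/orP; left; apply/path_arcsP; exists i, j.
by rewrite gP.2 => /andP[_ /eqP].
Qed.

Lemma iter_route_last i : iter (size (p i)) g (s i) = t ((val P).2 i).
Proof. by rewrite -nth_route // nth_route_last. Qed.

Lemma route_avoids_sinks i : avoids_sinks g (s i) (size (p i)).
Proof.
move=> j lt_j; rewrite -nth_route ?(ltnW lt_j) //.
have : (nth (s i) (r i) j, nth (s i) (r i) j.+1) \in path_arcs P.
  by apply/path_arcsP; exists i, j.
move=> /path_arcs_edge Ej.
have /gamma_edge_notin[] // : gamma_edge (nth (s i) (r i) j) (nth (s i) (r i) j.+1).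
by rewrite /gamma_edge Ej.
Qed.

Lemma follows_off v : v \notin sinks -> v \notin path_verts P -> g v = v.
Proof.
move=> vT vP; have : path_rel P v (g v) by rewrite gP.2 vT eqxx.
by case/orP=> [/path_arcs_verts|/andP[/eqP]//]; rewrite (negbTE vP).
Qed.

End Follows.
End MatchingOfPath.

(** One [g] follows both paths. Each route is the walk of [g] from its source, stopped at the first
    sink, so lengths, vertices and end points all agree; the end points give the permutations. *)
Lemma path_rel_determines P Q : path_rel P =2 path_rel Q -> P = Q.
Proof.
move=> eqPQ; have [g gP] := follows_exists P.
have gQ : follows Q g by split=> [|u v]; [exact: gP.1|rewrite -eqPQ gP.2].
have size_le (P' Q' : disjoint_path E s t) i : follows P' g -> follows Q' g ->
    (size ((val P').1 i) <= size ((val Q').1 i))%N.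
  move=> gP' gQ'; rewrite leqNgt; apply/negP => /(route_avoids_sinks gP').
  by rewrite (iter_route_last gQ') imset_f.
have size_eq i : size ((val P).1 i) = size ((val Q).1 i).
  by apply/eqP; rewrite eqn_leq !size_le.
apply: val_inj; apply/pair_eqP/andP; split; apply/eqP.
  apply/ffunP => i; apply: (@eq_from_nth _ (s i)) => // j lt_j.
  have ltQ_j : (j < size ((val Q).1 i))%N by rewrite -size_eq.
  by have := nth_route gP lt_j; rewrite -(nth_route gQ ltQ_j).
apply/permP => i; apply: t_inj.
by rewrite -(iter_route_last gP) -(iter_route_last gQ) size_eq.
Qed.

(** * Matchings as permutations of row indices, and their parity *)

Section Signs.
Local Notation m := #|inner|.
Variables (rS rT : 'I_(k + m) -> V).
Hypotheses (rS_inj : injective rS) (rT_inj : injective rT).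
Hypothesis rS_onto : forall v, reflect (exists i, rS i = v) (v \notin sinks).
Hypothesis rT_onto : forall v, reflect (exists i, rT i = v) (v \notin sources).
Hypothesis rS_first : forall i, rS (lshift m i) = s i.
Hypothesis rT_first : forall i, rT (lshift m i) = t i.

Lemma rS_notin i : rS i \notin sinks.
Proof. by apply/rS_onto; exists i. Qed.

Lemma rT_notin i : rT i \notin sources.
Proof. by apply/rT_onto; exists i. Qed.

Lemma matching_perm g : matching_fun g ->
  exists pi : {perm 'I_(k + m)}, forall i j, (rT j == g (rS i)) = (j == pi i).
Proof.
move=> [g_edge g_inj]; apply: perm_of_rel.
- move=> i; have /gamma_edge_notin[_ /rT_onto[j eq_j]] := g_edge _ (rS_notin i).
  by exists j; rewrite eq_j.
- by move=> i j j' /eqP<- /eqP/rT_inj.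
move=> i i' j /eqP-> /eqP eq_g; apply: rS_inj.
by apply: g_inj; rewrite ?inE ?rS_notin.
Qed.

Lemma matching_of_perm (pi : {perm 'I_(k + m)}) :
    (forall i, gamma_edge (rS i) (rT (pi i))) ->
  exists g, matching_fun g /\ forall i, g (rS i) = rT (pi i).
Proof.
move=> pi_edge.
have /fin_all_exists[g gP] v : exists w, forall i, rS i = v -> w = rT (pi i).
  case: (boolP (v \in sinks)) => [vT|/rS_onto[i eq_i]].
    by exists v => i eq_i; have := rS_notin i; rewrite eq_i vT.
  by exists (rT (pi i)) => i'; rewrite -eq_i => /rS_inj->.
have gE i : g (rS i) = rT (pi i) by apply: gP.
exists g; split=> //; split=> [v /rS_onto[i <-]|u v]; first by rewrite gE.
rewrite !inE => /rS_onto[i <-] /rS_onto[j <-].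
by rewrite !gE => /rT_inj/perm_inj->.
Qed.

(* Identifies each t_i with s_i and each v_t with v_s, so that a matching
   becomes a permutation of the row indices comparable with sigma_P. *)
Lemma reorder_exists : exists rho : {perm 'I_(k + m)},
  (forall i, rho (lshift m i) = lshift m i)
  /\ (forall j, rT j \notin sinks -> rS (rho j) = rT j).
Proof.
(* The row of [t i] is sent to that of [s i], and the row of an inner v_t to that of v_s. *)
pose rel j j' := if [pick i | rT j == t i] is Some i then j' == lshift m i
                 else rS j' == rT j.
have relT i j' : rel (lshift m i) j' = (j' == lshift m i).
  rewrite /rel; case: pickP => [i'|/(_ i)]; rewrite rT_first ?eqxx //.
  by move=> /eqP/t_inj->.
have relN j j' : rT j \notin sinks -> rel j j' = (rS j' == rT j).
  rewrite /rel => jT; case: pickP => // i /eqP eq_j.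
  by rewrite eq_j imset_f in jT.
have first_or_inner j : (exists i, j = lshift m i) \/ (rT j \notin sinks).
  case: (boolP (rT j \in sinks)) => [/imsetP[i _]|]; last by right.
  by rewrite -rT_first => /rT_inj->; left; exists i.
have [|||rho rhoE] := @perm_of_rel _ rel.
- move=> j; case: (first_or_inner j) => [[i ->]|jT].
    by exists (lshift m i); rewrite relT.
  by have /rS_onto[j' eq_j'] := jT; exists j'; rewrite relN // eq_j'.
- move=> j j1 j2; case: (first_or_inner j) => [[i ->]|jT].
    by rewrite !relT => /eqP-> /eqP->.
  by rewrite !relN // => /eqP<- /eqP/rS_inj.
- move=> j1 j2 j.
  case: (first_or_inner j1) (first_or_inner j2) => [[i1 ->]|j1T] [[i2 ->]|j2T].
  + by rewrite !relT => /eqP-> /eqP.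
  + rewrite relT relN // => /eqP-> /eqP; rewrite rS_first => eq_s.
    by have := rT_notin j2; rewrite -eq_s imset_f.
  + rewrite relT relN // => /eqP eq_s /eqP eq_j.
    move: eq_s; rewrite eq_j rS_first => eq_s.
    by have := rT_notin j1; rewrite -eq_s imset_f.
  by rewrite !relN // => /eqP-> /eqP/rT_inj.
exists rho; split=> [i|j jT]; apply/eqP; last by rewrite -relN // rhoE.
by rewrite eq_sym -rhoE relT.
Qed.

(** On indices of [rS], the product [pi * rho] acts as [g], except that arriving at [t j] it jumps
    to [s j]. [odd_perm_return] is applied to it, with [lshift] embedding the indices of the
    sources. *)
Lemma odd_matching_perm P g (pi rho : {perm 'I_(k + m)}) :
    follows P g -> (forall i, g (rS i) = rT (pi i)) ->
    (forall i, rho (lshift m i) = lshift m i) ->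
    (forall j, rT j \notin sinks -> rS (rho j) = rT j) ->
  odd_perm pi (+) odd #|[set i | rS i != rT (pi i)]|
    = odd_perm rho (+) odd k (+) odd_perm (val P).2.
Proof.
move=> gP gE rho_first rho_inner; pose pi0 := (pi * rho)%g.
pose len i := size ((val P).1 i); pose sg := (val P).2.
have lenE i : iter (len i) g (s i) = t (sg i) by apply: iter_route_last gP i.
have len_av i : avoids_sinks g (s i) (len i) by apply: route_avoids_sinks.
have len_gt0 i : (0 < len i)%N.
  rewrite lt0n; apply: contraNneq (source_notin_sinks i) => len0.
  by have := lenE i; rewrite len0 /= => ->; rewrite imset_f.
have stepN i : g (rS i) \notin sinks -> rS (pi0 i) = g (rS i).
  by move=> giT; rewrite permM gE rho_inner // -gE.
have stepT i j : g (rS i) = t j -> pi0 i = lshift m j.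
  by rewrite gE -rT_first permM => /rT_inj->.
have pi0_iter i j : (j < len i)%N -> rS ((pi0 ^+ j)%g (lshift m i)) = iter j g (s i).
  elim: j => [|j IH] lt_j; first by rewrite expg0 perm1 rS_first.
  have := len_av i _ lt_j; rewrite iterS -IH ?(ltnW lt_j) // => gT.
  by rewrite expgSr permM stepN.
(* The first return to the indices of the sources takes exactly as many steps as P_i has arcs, and
   it realizes [sg]. *)
have pi0_len i : (pi0 ^+ len i)%g (lshift m i) = lshift m (sg i).
  rewrite -(prednK (len_gt0 i)) expgSr permM; apply: stepT.
  by rewrite pi0_iter ?prednK // -iterS prednK.
have orb_fwd x y : y \in porbit sg x ->
    lshift m y \in porbit pi0 (lshift m x).
  move=> /porbitP[a ->]; elim: a => [|a IH]; first by rewrite expg0 perm1 porbit_id.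
  rewrite expgSr permM -pi0_len -eq_porbit_mem.
  apply: etrans (_ : (porbit pi0 (lshift m ((sg ^+ a)%g x)) == _) = true).
    by congr (_ == _); apply/eqP; rewrite eq_porbit_mem mem_porbit.
  by rewrite eq_porbit_mem.
(* Strong induction on [a]: before [len x] steps the walk meets no source except at time 0, and
   otherwise one full return can be removed. *)
have orb_bwd a x y : (pi0 ^+ a)%g (lshift m x) = lshift m y -> y \in porbit sg x.
  elim/ltn_ind: a x => a IH x eq_a; case: (ltnP a (len x)) => [lt_a|le_a].
    have := pi0_iter _ _ lt_a; rewrite eq_a rS_first.
    case: a lt_a {IH eq_a} => [_ /s_inj->|a lt_a eq_s]; first exact: porbit_id.
    have /eqP[] // : iter a.+1 g (s x) != s y.
    apply: (iter_neq_source gP.1) => j lt_j; apply: len_av.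
    exact: leq_trans lt_j (ltnW lt_a).
  have := IH (a - len x)%N; rewrite ltn_subrL len_gt0 (leq_trans (len_gt0 x) le_a).
  move=> /(_ isT (sg x)); rewrite -pi0_len -permM -expgnDr subnKC // => /(_ eq_a).
  move=> ysg; rewrite -eq_porbit_mem; apply/eqP.
  have /eqP-> : porbit sg y == porbit sg (sg x) by rewrite eq_porbit_mem.
  by apply/eqP; rewrite eq_porbit_mem (mem_porbit sg 1).
pose off := [set z | [forall x, z \notin porbit pi0 (lshift m x)]].
have off_fix z : z \in off -> g (rS z) = rS z.
  rewrite inE => /forallP zoff; apply: (follows_off gP); first exact: rS_notin.
  apply/path_vertsP => -[i [j [le_j]]]; rewrite (nth_route gP) // => eq_z.
  have lt_j : (j < len i)%N.
    rewrite ltn_neqAle le_j andbT; apply: contraNneq (rS_notin z) => eq_j.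
    by rewrite eq_z eq_j lenE imset_f.
  move: eq_z (zoff i); rewrite -pi0_iter // => /rS_inj->.
  by rewrite mem_porbit.
have fix_pi0 z : g (rS z) = rS z -> pi0 z = z.
  by move=> gz; apply: rS_inj; rewrite stepN gz // rS_notin.
have offE : off = ~: [set i | rS i != rT (pi i)].
  apply/setP => z; rewrite in_setC [X in _ = ~~ X]inE negbK -gE eq_sym.
  apply/idP/eqP => [/off_fix//|gz]; rewrite inE; apply/forallP => x.
  apply/negP => /porbitP[a eq_z].
  have fixa b : (pi0 ^+ b)%g z = z.
    elim: b => [|b IH]; first by rewrite expg0 perm1.
    by rewrite expgSr permM IH fix_pi0.
  have eq_zx : z = lshift m x by apply: (@perm_inj _ (pi0 ^+ a)%g); rewrite fixa.
  have /eqP[] := source_moved gP.1 x; by move: gz; rewrite eq_zx rS_first.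
have orbE x y : (lshift m y \in porbit pi0 (lshift m x)) = (y \in porbit sg x).
  by apply/idP/idP => [/porbitP[a /esym/orb_bwd]|/orb_fwd].
have := odd_perm_return orbE (erefl off) (fun z zoff => fix_pi0 z (off_fix z zoff)).
(* By complement, [#|off|] is k + m minus the number of arcs used; the two occurrences of k + m
   cancel modulo 2. *)
rewrite odd_permM offE !card_ord; have := cardsC [set i | rS i != rT (pi i)].
rewrite card_ord => /(congr1 odd) <-; rewrite oddD.
by do 3!case: (odd _); case: (odd_perm pi); case: (odd_perm rho); case: (odd_perm sg).
Qed.


(** * Column sets: column [l] stands for the edge joining [u l] on the S side to [w l] on the T
    side *)

Section Columns.
Variables (M : nat) (u w : 'I_M -> V).
Hypothesis uw_inj : forall l l', u l = u l' -> w l = w l' -> l = l'.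
Hypothesis uw_edge : forall l, gamma_edge (u l) (w l).
Hypothesis uw_onto :
  forall a b, gamma_edge a b -> exists l, u l = a /\ w l = b.

(** An acyclic graph has no loops, so among the edges of Gamma equal ends single out those of F2. *)
Definition arc_sign (a b : V) : rat := if a == b then 1 else -1.

(* A1[B] times the transpose of A2[B]. *)
Definition pairing_mx (B : {set 'I_M}) : 'M[rat]_(k + m) :=
  \matrix_(i, j) \sum_(l in B)
    (rS i == u l)%:R * arc_sign (u l) (w l) * (rT j == w l)%:R.

Definition perm_cols (pi : {perm 'I_(k + m)}) : {set 'I_M} :=
  [set l | [exists i, (rS i == u l) && (rT (pi i) == w l)]].

Definition path_cols (P : disjoint_path E s t) : {set 'I_M} :=
  [set l | path_rel P (u l) (w l)].

Lemma card_perm_cols (pi : {perm 'I_(k + m)}) :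
    (forall i, gamma_edge (rS i) (rT (pi i))) ->
  #|perm_cols pi| = (k + m)%N.
Proof.
move=> /(_ _)/uw_onto edge_pi; have /fin_all_exists[f fP] := edge_pi.
have f_inj : injective f.
  by move=> i i' eq_f; apply: rS_inj; rewrite -(fP i).1 -(fP i').1 eq_f.
suff -> : perm_cols pi = f @: setT by rewrite card_imset // cardsT card_ord.
apply/setP => l; rewrite inE; apply/existsP/imsetP.
  case=> i /andP[/eqP eu /eqP ew].
  by exists i => //; apply: uw_inj; rewrite ?(fP i).1 ?(fP i).2.
by case=> i _ ->; exists i; rewrite (fP i).1 (fP i).2 !eqxx.
Qed.

Lemma pairing_perm_cols (pi : {perm 'I_(k + m)}) :
    (forall i, gamma_edge (rS i) (rT (pi i))) ->
  pairing_mx (perm_cols pi)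
    = diag_mx (\row_i arc_sign (rS i) (rT (pi i))) *m perm_mx pi.
Proof.
move=> edge_pi; apply/matrixP => i j; rewrite mul_diag_mx !mxE.
have [l [eu ew]] := uw_onto (edge_pi i).
have l_pi : l \in perm_cols pi.
  by rewrite inE; apply/existsP; exists i; rewrite eu ew !eqxx.
rewrite (bigD1 l) //= big1 => [|l' /andP[]].
  by rewrite eu ew eqxx mul1r addr0 (inj_eq rT_inj) eq_sym.
rewrite inE => /existsP[i' /andP[/eqP eu' /eqP ew']] neq_l.
rewrite -eu' (inj_eq rS_inj); case: eqP => [eq_i|_]; last by rewrite !mul0r.
by case/eqP: neq_l; apply: uw_inj; rewrite -?eu' -?ew' -eq_i.
Qed.

Lemma det_pairing_perm_cols (pi : {perm 'I_(k + m)}) :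
    (forall i, gamma_edge (rS i) (rT (pi i))) ->
  \det (pairing_mx (perm_cols pi))
    = (-1) ^+ (odd_perm pi (+) odd #|[set i | rS i != rT (pi i)]|).
Proof.
move=> edge_pi; rewrite pairing_perm_cols // det_mulmx det_diag det_perm.
rewrite signr_addb signr_odd mulrC; congr (_ * _).
rewrite -prodr_const [RHS]big_mkcond /=.
by apply: eq_bigr => i _; rewrite !mxE inE /arc_sign; case: eqP.
Qed.

(** A nonsingular matrix has no zero row or column, so [B] covers every vertex of both sides. Since
    [B] has as many edges as each side has vertices, every vertex is covered exactly once. *)
Lemma perm_cols_of_unit (B : {set 'I_M}) : #|B| = (k + m)%N -> pairing_mx B \in unitmx ->
  exists pi : {perm 'I_(k + m)},
    (forall i, gamma_edge (rS i) (rT (pi i))) /\ B = perm_cols pi.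
Proof.
move=> cardB unitB.
have entry i j : pairing_mx B i j != 0 ->
    exists l, [/\ l \in B, u l = rS i & w l = rT j].
  rewrite mxE; case: (pickP [pred l in B | (rS i == u l) && (rT j == w l)]).
    by move=> l /and3P[lB /eqP eu /eqP ew] _; exists l.
  move=> none; rewrite big1 ?eqxx // => l lB; have := none l.
  rewrite /= lB /=; case: eqP => [_|_ _]; last by rewrite !mul0r.
  by case: eqP => // _ _; rewrite mulr0.
have /fin_all_exists[f fP] i : exists l, l \in B /\ u l = rS i.
  by have [j /entry[l [lB eu _]]] := unitmx_row_neq0 i unitB; exists l.
have /fin_all_exists[h hP] j : exists l, l \in B /\ w l = rT j.
  have [i] := unitmx_row_neq0 j (etrans (unitmx_tr _) unitB).
  by rewrite mxE => /entry[l [lB _ ew]]; exists l.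
have onto (f' : 'I_(k + m) -> 'I_M) : injective f' -> (forall i, f' i \in B) ->
    forall l, l \in B -> exists i, f' i = l.
  move=> f'_inj f'B l lB; have : l \in f' @: setT.
    suff /eqP-> : f' @: setT == B by [].
    rewrite eqEcard card_imset // cardsT card_ord cardB leqnn andbT.
    by apply/subsetP => _ /imsetP[i _ ->].
  by case/imsetP => i _ ->; exists i.
have f_onto : forall l, l \in B -> exists i, f i = l.
  apply: onto => [i i' eq_f|i]; last exact: (fP i).1.
  by apply: rS_inj; rewrite -(fP i).2 -(fP i').2 eq_f.
have h_onto : forall l, l \in B -> exists j, h j = l.
  apply: onto => [j j' eq_h|j]; last exact: (hP j).1.
  by apply: rT_inj; rewrite -(hP j).2 -(hP j').2 eq_h.
(* Every edge of [B] is some [h j], and its T end [rT j] determines [j]; edges of [B] sharing a T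
   end therefore coincide. *)
have f_inj i i' : w (f i) = w (f i') -> i = i'.
  have [[j def_j] [j' def_j']] := (h_onto _ (fP i).1, h_onto _ (fP i').1).
  rewrite -def_j -def_j' (hP j).2 (hP j').2 => /rT_inj eq_j.
  by apply: rS_inj; rewrite -(fP i).2 -(fP i').2 -def_j -def_j' eq_j.
have [|i j j' /eqP<- /eqP/rT_inj//|i i' j /eqP-> /eqP/f_inj//|pi piE] :=
  @perm_of_rel _ (fun i j => rT j == w (f i)).
  move=> i; have /gamma_edge_notin[_ /rT_onto[j eq_j]] := uw_edge (f i).
  by exists j; rewrite eq_j.
have wf i : w (f i) = rT (pi i) by apply/esym/eqP; rewrite piE.
exists pi; split=> [i|]; first by rewrite -wf -(fP i).2.
apply/setP => l; rewrite inE; apply/idP/existsP => [/f_onto[i <-]|[i]].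
  by exists i; rewrite (fP i).2 wf !eqxx.
case/andP => /eqP eu /eqP ew; have <- : f i = l; last exact: (fP i).1.
by apply: uw_inj; rewrite ?(fP i).2 ?wf.
Qed.

Lemma path_colsP P : exists g (pi : {perm 'I_(k + m)}),
  [/\ follows P g, forall i, g (rS i) = rT (pi i),
      forall i, gamma_edge (rS i) (rT (pi i)) & path_cols P = perm_cols pi].
Proof.
have [g gP] := follows_exists P; have [pi piE] := matching_perm gP.1.
have gE i : g (rS i) = rT (pi i) by apply/esym/eqP; rewrite piE.
exists g, pi; split=> // [i|]; first by rewrite -gE; apply: gP.1.1; apply: rS_notin.
apply/setP => l; rewrite !inE gP.2; apply/andP/existsP.
  by case=> /rS_onto[i <-] /eqP->; exists i; rewrite gE !eqxx.
by case=> i /andP[/eqP<- /eqP<-]; rewrite rS_notin gE.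
Qed.

Lemma path_of_perm_cols (pi : {perm 'I_(k + m)}) :
    (forall i, gamma_edge (rS i) (rT (pi i))) ->
  exists P : disjoint_path E s t, path_cols P = perm_cols pi.
Proof.
move=> edge_pi; have [g [gP gE]] := matching_of_perm edge_pi.
have [P PP] := disjoint_path_of_matching gP; exists P.
have [g' [pi' [g'P g'E edge_pi' ->]]] := path_colsP P.
(* Both column sets have k + m elements, so one inclusion suffices. *)
apply/esym/eqP; rewrite eqEcard !card_perm_cols // leqnn andbT.
apply/subsetP => l; rewrite !inE => /existsP[i /andP[/eqP eu /eqP ew]].
apply/existsP; exists i; rewrite eu eqxx -ew -g'E -gE.
by have := PP _ (rS_notin i); rewrite g'P.2 eq_sym => /andP[].
Qed.

Lemma path_cols_inj : injective path_cols.
Proof.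
move=> P Q eqPQ; apply: path_rel_determines => a b.
have sub P' Q' : path_cols P' = path_cols Q' -> path_rel P' a b -> path_rel Q' a b.
  move=> eq_cols ab; have [l [eu ew]] := uw_onto (path_rel_edge ab).
  by move/setP/(_ l): eq_cols; rewrite !inE eu ew ab => <-.
by apply/idP/idP; apply: sub.
Qed.

(** The bit [b] is chosen before [P]: it collects the parities of [rho] and of [k], leaving sigma_P
    as the only dependence on the path. *)
Lemma det_path_cols : exists b : bool, forall P,
  \det (pairing_mx (path_cols P)) = (-1) ^+ (b (+) odd_perm (val P).2).
Proof.
have [rho [rho_first rho_inner]] := reorder_exists.
exists (odd_perm rho (+) odd k) => P.
have [g [pi [gP gE edge_pi ->]]] := path_colsP P.
by rewrite det_pairing_perm_cols // (odd_matching_perm gP gE rho_first rho_inner).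
Qed.

Lemma path_cols_base P :
  #|path_cols P| = (k + m)%N /\ pairing_mx (path_cols P) \in unitmx.
Proof.
have [b detP] := det_path_cols; split.
  by have [g [pi [_ _ edge_pi ->]]] := path_colsP P; apply: card_perm_cols.
by rewrite unitmxE detP unitrX // unitrN1.
Qed.

Lemma base_path_cols (B : {set 'I_M}) :
  #|B| = (k + m)%N -> pairing_mx B \in unitmx -> exists P, path_cols P = B.
Proof.
by move=> cardB /(perm_cols_of_unit cardB)[pi [/path_of_perm_cols ? ->]].
Qed.

End Columns.
End Signs.

(** * Vertices and edges of Gamma in terms of vertices of G *)

Lemma mem_sources_inner v : (v \in sources :|: inner) = (v \notin sinks).
Proof.
rewrite in_setU in_setC in_setU; case: (boolP (v \in sources)) => //= vS.
by rewrite (disjointFr disjST vS).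
Qed.

Lemma mem_sinks_inner v : (v \in sinks :|: inner) = (v \notin sources).
Proof.
rewrite in_setU in_setC in_setU; case: (boolP (v \in sinks)) => //= vT.
  by rewrite (disjointFl disjST vT).
by rewrite orbF.
Qed.

Lemma inl_F1_edge a v : ((inl v : V + V) \in F1_edge a) = (v == a.1).
Proof. by rewrite !inE orbF. Qed.

Lemma inr_F1_edge a v : ((inr v : V + V) \in F1_edge a) = (v == a.2).
Proof. by rewrite !inE. Qed.

Lemma F1_edge_inj : injective (@F1_edge V).
Proof.
move=> a b eq_ab; apply/pair_eqP/andP; split; apply/eqP.
  by apply/eqP; rewrite -inl_F1_edge -eq_ab inl_F1_edge.
by apply/eqP; rewrite -inr_F1_edge -eq_ab inr_F1_edge.
Qed.

(** An edge of F2 at [v] is [F1_edge (v, v)], which lets ordered pairs of vertices encode both kinds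
    of edges. *)
Lemma mem_F e :
  e \in F E s t <-> exists a b, gamma_edge a b /\ e = F1_edge (a, b).
Proof.
rewrite in_setU; split=> [/orP[]/imsetP[]|[a [b [/orP[Eab|/andP[/eqP<- ai]] ->]]]].
- by move=> [a b]; rewrite inE => Eab ->; exists a, b; rewrite /gamma_edge Eab.
- by move=> v vi ->; exists v, v; rewrite /gamma_edge eqxx vi orbT.
- by apply/orP; left; apply/imsetP; exists (a, b); rewrite ?inE.
by apply/orP; right; apply/imsetP; exists a.
Qed.

Lemma edge_sign_F1_edge a b : gamma_edge a b ->
  edge_sign E s t (F1_edge (a, b)) = arc_sign a b.
Proof.
move=> ab; rewrite /edge_sign /arc_sign; congr (if _ then _ else _).
apply/exists_inP/eqP => [[x /imsetP[v _ ->] /exists_inP[y /imsetP[v' _ ->]]]|eq_ab].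
  case/andP => /eqP /(@F1_edge_inj (a, b) (v, v'))[-> ->].
  case/orP => /and3P[]; first by case/imsetP.
  by move=> _ _ /imsetP[v'' _ /(@F1_edge_inj (v, v') (v'', v''))[-> ->]].
subst b; have ai : a \in inner.
  by move: ab; rewrite /gamma_edge acyclic_irrefl // eqxx.
have aS : inl a \in VS s t by rewrite imset_f // in_setU ai orbT.
have aT : inr a \in VT s t by rewrite imset_f // in_setU ai orbT.
exists (inl a) => //; apply/exists_inP; exists (inr a) => //.
rewrite eqxx /=; apply/orP; right; apply/and3P; split=> //.
by apply/imsetP; exists a.
Qed.

Lemma mem_path_matching (P : disjoint_path E s t) a b :
  (F1_edge (a, b) \in path_matching P) = path_rel P a b.
Proof.
rewrite in_setU; congr (_ || _); first by rewrite (mem_imset _ _ F1_edge_inj).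
apply/imsetP/andP => [[v vi /(@F1_edge_inj (a, b) (v, v))[-> ->]]|[/eqP<- ai]].
  by rewrite eqxx.
by exists a.
Qed.

Lemma path_matching_sub_F (P : disjoint_path E s t) : path_matching P \subset F E s t.
Proof.
apply/subsetP => e; rewrite in_setU => /orP[]/imsetP[].
  move=> [a b] ab ->; apply/mem_F; exists a, b; split=> //.
  by rewrite /gamma_edge (path_arcs_edge ab).
move=> v; rewrite in_setD => /andP[_ vi] ->; apply/mem_F; exists v, v.
by rewrite /gamma_edge eqxx vi orbT.
Qed.

End Matchings.

(** * The bijection and the Pfaffian constant *)

Theorem theorem4p4 (V : finType) (E : rel V) (k : nat) (s t : 'I_k -> V)
    (acyclicE : acyclic E)
    (s_inj : injective s) (t_inj : injective t)
    (disjST : [disjoint sources s & sinks t])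
    (s_in0 : forall (i : 'I_k) (v : V), ~~ E v (s i))
    (t_out0 : forall (j : 'I_k) (v : V), ~~ E (t j) v)
    (rowS rowT : 'I_(k + #|inner s t|) -> V + V)
    (rowS_enum : enumerates rowS (VS s t))
    (rowT_enum : enumerates rowT (VT s t))
    (rowS_first : forall i : 'I_k, rowS (lshift #|inner s t| i) = inl (s i))
    (rowT_first : forall i : 'I_k, rowT (lshift #|inner s t| i) = inr (t i))
    (col : 'I_#|F E s t| -> {set V + V})
    (col_enum : enumerates col (F E s t)) :
  let A1 := vecA1 E s t rowS col in
  let A2 := vecA2 rowT col in
  (exists f : disjoint_path E s t ->
              {B : {set 'I_#|F E s t|} | common_base A1 A2 B},
     bijective f /\
     forall P : disjoint_path E s t, col @: val (f P) = path_matching P)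
  /\
  (LGV_position E s t ->
   exists c : rat, (c = 1 \/ c = -1) /\ Pfaffian_pair A1 A2 c).
Proof.
move=> A1 A2.
(* The tags [inl] and [inr] are stripped from the rows, and each column is replaced by its pair of
   ends, to fit the preceding sections. *)
have /fin_all_exists[rS rowSE] i : exists v, rowS i = inl v.
  have: rowS i \in VS s t by rewrite -rowS_enum.2 imset_f.
  by case/imsetP => v _ ->; exists v.
have /fin_all_exists[rT rowTE] i : exists v, rowT i = inr v.
  have: rowT i \in VT s t by rewrite -rowT_enum.2 imset_f.
  by case/imsetP => v _ ->; exists v.
have rS_inj : injective rS.
  by move=> i i' eq_i; apply: rowS_enum.1; rewrite !rowSE eq_i.
have rT_inj : injective rT.
  by move=> i i' eq_i; apply: rowT_enum.1; rewrite !rowTE eq_i.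
have rS_onto v : reflect (exists i, rS i = v) (v \notin sinks t).
  rewrite -(mem_sources_inner disjST) -(mem_imset _ _ (@inl_inj V V)).
  rewrite -/(VS s t) -rowS_enum.2; apply: (iffP imsetP) => [[i _]|[i <-]].
    by rewrite rowSE => -[->]; exists i.
  by exists i.
have rT_onto v : reflect (exists i, rT i = v) (v \notin sources s).
  rewrite -(mem_sinks_inner disjST) -(mem_imset _ _ (@inr_inj V V)).
  rewrite -/(VT s t) -rowT_enum.2; apply: (iffP imsetP) => [[i _]|[i <-]].
    by rewrite rowTE => -[->]; exists i.
  by exists i.
have rS_first i : rS (lshift _ i) = s i by have := rowS_first i; rewrite rowSE => -[].
have rT_first i : rT (lshift _ i) = t i by have := rowT_first i; rewrite rowTE => -[].
have /fin_all_exists[uw uwP] l : exists a : V * V,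
    gamma_edge E s t a.1 a.2 /\ col l = F1_edge a.
  have /mem_F[a [b [ab col_l]]] : col l \in F E s t by rewrite -col_enum.2 imset_f.
  by exists (a, b).
pose u l := (uw l).1; pose w l := (uw l).2.
have colE l : col l = F1_edge (u l, w l) by rewrite (uwP l).2 /u /w; case: (uw l).
have uw_inj l l' : u l = u l' -> w l = w l' -> l = l'.
  by move=> eu ew; apply: col_enum.1; rewrite !colE eu ew.
have uw_edge l : gamma_edge E s t (u l) (w l) := (uwP l).1.
have uw_onto a b : gamma_edge E s t a b -> exists l, u l = a /\ w l = b.
  move=> ab; have : F1_edge (a, b) \in col @: setT.
    by rewrite col_enum.2; apply/mem_F; exists a, b.
  case/imsetP => l _; rewrite colE => /F1_edge_inj[-> ->].
  by exists l.
have entryE (B : {set 'I_#|F E s t|}) :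
    \matrix_(i, j) (\sum_(l in B) A1 i l * A2 j l) = pairing_mx rS rT u w B.
  apply/matrixP => i j; rewrite !mxE; apply: eq_bigr => l _.
  rewrite /A1 /vecA1 mul_mx_diag !mxE rowSE rowTE colE.
  by rewrite inl_F1_edge inr_F1_edge edge_sign_F1_edge.
have baseE B : common_base A1 A2 B =
    (#|B| == (k + #|inner s t|)%N) && (pairing_mx rS rT u w B \in unitmx).
  by rewrite common_baseE entryE.
have path_base (P : disjoint_path E s t) : common_base A1 A2 (path_cols u w P).
  have [] // := path_cols_base s_inj t_inj disjST s_in0 t_out0 rS_inj rT_inj
    rS_onto rT_onto rS_first rT_first uw_inj uw_onto P.
  by rewrite baseE => -> ->; rewrite eqxx.
have base_path B : common_base A1 A2 B ->
    exists P : disjoint_path E s t, path_cols u w P = B.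
  rewrite baseE => /andP[/eqP cardB unitB].
  exact: (base_path_cols acyclicE s_inj disjST s_in0 t_out0 rS_inj rT_inj
    rS_onto rT_onto uw_inj uw_edge uw_onto cardB unitB).
split.
  pose f P : {B | common_base A1 A2 B} := exist _ (path_cols u w P) (path_base P).
  exists f; split.
    have f_onto B : exists P, f P == B.
      have [P PB] := base_path _ (valP B).
      by exists P; apply/eqP/val_inj.
    exists (fun B => xchoose (f_onto B)) => [P|B]; last exact/eqP/(xchooseP (f_onto B)).
    have /eqP/(congr1 val) := xchooseP (f_onto (f P)).
    exact: (path_cols_inj t_inj s_in0 t_out0 uw_onto).
  move=> P; apply/setP => e; apply/imsetP/idP => [[l + ->]|eP].
    by rewrite inE colE mem_path_matching.
  have /mem_F[a [b [ab def_e]]] := subsetP (path_matching_sub_F P) e eP.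
  have [l [eu ew]] := uw_onto a b ab; exists l; last by rewrite colE eu ew.
  by rewrite inE eu ew -mem_path_matching -def_e.
move=> lgv.
have [b detP] := det_path_cols s_inj t_inj disjST s_in0 t_out0 rS_inj rT_inj
  rS_onto rT_onto rS_first rT_first uw_inj uw_onto.
have detE B : common_base A1 A2 B ->
    \det (col_submx A1 B) * \det (col_submx A2 B) = \det (pairing_mx rS rT u w B).
  rewrite baseE => /andP[/eqP cardB _].
  by rewrite -(det_tr (col_submx A2 B)) -det_mulmx mul_col_submx // entryE.
(* The constant is the value at some common base. When there is none, the condition is vacuous and 1
   is taken. *)
case: (pickP (common_base A1 A2)) => [B0 /base_path[P0 _]|no_base]; last first.
  by exists 1; split; [left|split; rewrite ?oner_eq0 // => B; rewrite no_base].
exists ((-1) ^+ (b (+) odd_perm (val P0).2)); split.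
  by case: (_ (+) _); [right|left].
split=> [|B base_B]; first by rewrite signr_eq0.
have [P def_B] := base_path B base_B.
rewrite detE // -def_B detP; congr ((-1) ^+ nat_of_bool (b (+) _)).
have := lgv P P0; rewrite /sgn_path.
by case: (odd_perm _); case: (odd_perm _).
Qed.
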